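(* Let $\Delta,k$ be positive integers and $\varepsilon$ a real number with $\Delta^{-7}/1000\ge\varepsilon\ge 3k^{-1}$. Let $G$ be a connected graph with $|G|\ge(1+256\Delta^2\sqrt{\varepsilon})k$ and $\delta(G)\ge 128\Delta^2\sqrt{\varepsilon}\,k$, containing a (non-empty) subgraph $K$ with $|K|\le(1+\varepsilon)k$ and $\delta(K)\ge(1-\varepsilon)k$. Then $G$ contains a copy of every $k$-edge tree $T$ with maximum degree $\Delta(T)\le\Delta$.
   Context: Graphs are finite and simple; $|G|$ denotes the number of vertices and $\delta(G)$ the minimum degree. A copy of $T$ in $G$ is a (not necessarily induced) subgraph of $G$ isomorphic to $T$. *)

(* Defs.v *)
From HB Require Import structures.
From mathcomp Require Import all_boot all_order all_algebra.
From mathcomp Require Import reals.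
Set Implicit Arguments.
Unset Strict Implicit.
Unset Printing Implicit Defensive.

Record sgraph := SGraph {
  svertex :> finType;
  sedge : rel svertex;
  sedge_sym : symmetric sedge;
  sedge_irr : irreflexive sedge }.

Definition neighbours (G : sgraph) (x : G) : {set G} := [set y | sedge x y].

Definition degree (G : sgraph) (x : G) : nat := #|neighbours x|.

(* Every degree is less than #|G|, so the default value #|G| plays no role in
   the minimum unless G is empty (and then min_degree G = 0). *)
Definition min_degree (G : sgraph) : nat := \big[minn/#|G|]_(x : G) degree x.

Definition max_degree (G : sgraph) : nat := \max_(x : G) degree x.

Definition edge_set (G : sgraph) : {set {set G}} :=
  [set [set p.1; p.2] | p : G * G & sedge p.1 p.2].

Definition connected (G : sgraph) : Prop :=
  0 < #|G| /\ forall x y : G, connect (@sedge G) x y.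

(* [ucycle] also accepts [:: x; y] for every edge xy, whence the bound 3. *)
Definition acyclic (G : sgraph) : Prop :=
  forall c : seq G, ucycle (@sedge G) c -> size c < 3.

Definition is_tree (G : sgraph) : Prop := connected G /\ acyclic G.

(* Not necessarily induced. *)
Record subgraph (G : sgraph) := Subgraph {
  sub_verts : {set G};
  sub_edge : rel G;
  sub_edge_sym : symmetric sub_edge;
  sub_edge_vert : forall x y, sub_edge x y -> x \in sub_verts;
  sub_edge_sub : forall x y, sub_edge x y -> sedge x y }.

Section SubgraphAsGraph.
Variables (G : sgraph) (H : subgraph G).

Definition sub_rel : rel {x : G | x \in sub_verts H} :=
  fun x y => sub_edge H (val x) (val y).

Lemma sub_rel_sym : symmetric sub_rel.
Proof. by move=> x y; apply: sub_edge_sym. Qed.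

Lemma sub_rel_irr : irreflexive sub_rel.
Proof.
by move=> x; apply/negP => /sub_edge_sub; rewrite sedge_irr.
Qed.

Definition sgraph_of_subgraph : sgraph := SGraph sub_rel_sym sub_rel_irr.
End SubgraphAsGraph.

Coercion sgraph_of_subgraph : subgraph >-> sgraph.

Definition isomorphic (G H : sgraph) : Prop :=
  exists2 f : G -> H, bijective f & forall x y, sedge (f x) (f y) = sedge x y.

Definition contains_copy (G T : sgraph) : Prop :=
  exists H : subgraph G, isomorphic T H.

(* Main.v *)
Require Import Defs.
From HB Require Import structures.
From mathcomp Require Import all_boot all_order all_algebra.
From mathcomp Require Import reals.
From mathcomp Require Import zify ring lra.
Import Order.TTheory GRing.Theory Num.Theory.

(* Idea. Every vertex of the almost complete graph K misses O(eps k) vertices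
   of K, so a partial embedding of T extends greedily into K as long as O(Delta
   eps k) vertices of K stay free: it suffices to place m = O(Delta eps k)
   vertices of T outside K. Let A be the set of vertices outside K with many
   neighbours in K.
   If |A| >= m, choose m vertices of T at pairwise distance at least 3, put them
   in A and their neighbours in K, and complete greedily in K.
   If |A| < m, the set C of the remaining vertices outside K is nonempty and
   induces a graph of large minimum degree; connectivity gives an edge zc with c
   in C and z outside C, and z has many neighbours in K. Some edge uv of T cuts
   off a branch at u with between m and Delta m + 1 vertices: map v to z, the
   branch into C starting with u at c, and the rest of T greedily into K. *)

Lemma card_bigcup_le (A B : finType) (P : {set A}) (F : A -> {set B}) (c : nat) :
  {in P, forall i, #|F i| <= c} -> #|\bigcup_(i in P) F i| <= #|P| * c.
Proof.
move=> Fle; rewrite -sum_nat_const.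
elim/big_rec2: _ => [|i c' U iP le]; first by rewrite cards0.
by apply: leq_trans (leq_card_setU _ _) _; rewrite leq_add ?Fle.
Qed.

(** * Partial embeddings and their greedy extension *)

Section PartialEmbeddings.
Variables T G : sgraph.
Implicit Types (D W : {set T}) (f : T -> G).

(** The map is total, but only its values on [D] are constrained, so a domain can grow by changing
    one value at a time. Edges need not be reflected, since copies need not be induced. *)
Definition partial_embedding D f : Prop :=
  {in D &, injective f} /\ {in D &, forall x y, sedge x y -> sedge (f x) (f y)}.

Definition extend f (x : T) (z : G) : T -> G := fun y => if y == x then z else f y.

Lemma extend_same f x z : extend f x z x = z.
Proof. by rewrite /extend eqxx. Qed.

Lemma extend_in f D x z : x \notin D -> {in D, extend f x z =1 f}.
Proof. by move=> xD y yD; rewrite /extend; case: eqP => // yx; rewrite -yx yD in xD. Qed.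

Lemma imset_extend f D x z :
  x \notin D -> extend f x z @: (x |: D) = z |: f @: D.
Proof.
move=> xD; rewrite imsetU1 extend_same; congr (_ |: _).
exact/eq_in_imset/extend_in.
Qed.

Lemma partial_embedding_extend D f x z :
  partial_embedding D f -> x \notin D -> z \notin f @: D ->
  {in D, forall y, sedge x y -> sedge z (f y)} ->
  partial_embedding (x |: D) (extend f x z).
Proof.
move=> [finj fhom] xD zD zadj; have fE := extend_in f D x z xD.
split=> y1 y2 /setU1P[->|y1D] /setU1P[->|y2D]; rewrite ?extend_same ?fE //.
- by move=> zE; rewrite zE imset_f in zD.
- by move=> zE; rewrite -zE imset_f in zD.
- exact: finj.
- by rewrite sedge_irr.
- exact: zadj.
- by rewrite sedge_sym => xy1; rewrite sedge_sym zadj.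
- exact: fhom.
Qed.

(* A new vertex avoids the images used so far and, for each of its at most
   [Delta] embedded neighbours, the at most [b] non-neighbours in [X]. *)
Lemma greedy_extension (Delta b : nat) (X : {set G}) (S : T -> {set G}) D W f :
  (forall x : T, degree x <= Delta) ->
  {in X, forall y, #|X :\: neighbours y| <= b} ->
  partial_embedding D f -> [disjoint D & W] ->
  {in W, forall w, S w \subset X} ->
  {in W & D, forall w u, sedge w u -> f u \in X \/ S w \subset neighbours (f u)} ->
  {in W, forall w, Delta * b + #|X :&: f @: D| + #|W| <= #|S w|} ->
  exists g, [/\ partial_embedding (D :|: W) g, {in D, g =1 f}
    & {in W, forall w, g w \in X}].
Proof.
move=> degT defX; move: {2}#|W| (erefl #|W|) => n.
elim: n D W f => [|n IHn] D W f cW embf dDW SX SN Scard.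
  move/eqP: cW; rewrite cards_eq0 => /eqP W0; subst W; exists f.
  by rewrite setU0; split=> // w; rewrite inE.
have /card_gt0P[w wW] : 0 < #|W| by rewrite cW.
have wD : w \notin D by rewrite (disjointFl dDW wW).
pose U := [set u in D | (u \in neighbours w) && (f u \in X)].
pose bad := (X :&: f @: D) :|: \bigcup_(u in U) (X :\: neighbours (f u)).
have badle : #|\bigcup_(u in U) (X :\: neighbours (f u))| <= Delta * b.
  apply: leq_trans (card_bigcup_le _ _ _ _ b _) _.
    by move=> u; rewrite inE => /and3P[_ _ fuX]; apply: defX.
  rewrite leq_mul2r; apply/orP; right.
  apply: leq_trans (degT w); apply: subset_leq_card.
  by apply/subsetP=> u; rewrite inE => /and3P[].
have [y yS ybad] : exists2 y, y \in S w & y \notin bad.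
  (* [W] contains [w], so the term [#|W|] makes [S w] strictly larger than [bad]. *)
  apply/subsetPn; apply/negP => /subset_leq_card Sbad.
  have := leq_trans (Scard w wW) Sbad.
  have := cardsU (X :&: f @: D) (\bigcup_(u in U) (X :\: neighbours (f u))).
  rewrite -/bad; lia.
have yX : y \in X by apply: subsetP (SX w wW) _ yS.
move: ybad; rewrite !inE yX /= negb_or => /andP[yfD ynot].
have emb' : partial_embedding (w |: D) (extend f w y).
  apply: partial_embedding_extend => // u uD wu.
  case: (SN w u wW uD wu) => [fuX|/subsetP/(_ _ yS)]; last first.
    by rewrite inE sedge_sym.
  apply: contraR ynot => nadj; apply/bigcupP; exists u.
    by rewrite !inE uD wu.
  by rewrite !inE yX sedge_sym nadj.
have fE := extend_in f D w y wD.
have DWE : w |: D :|: W :\ w = D :|: W.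
  by apply/setP=> x; rewrite !inE; case: eqP => [->|]; rewrite ?wW ?orbT.
have [|||||g [embg gf gX]] := IHn (w |: D) (W :\ w) (extend f w y) _ emb'.
- by move: (cardsD1 w W); rewrite wW cW; lia.
- rewrite -setI_eq0; apply/eqP/setP=> x; rewrite !inE.
  case: (eqVneq x w) => [->|_] //=; apply/negP=> /andP[xD xW].
  by rewrite (disjointFr dDW xD) in xW.
- by move=> x /setD1P[_]; apply: SX.
- move=> x u /setD1P[_ xW] /setU1P[->|uD] xu; first by left; rewrite extend_same.
  by rewrite fE //; apply: SN.
(* The used part of [X] gains at most the vertex [y] while [W] loses [w], so the required bound
   carries over. *)
- move=> x /setD1P[_ xW]; apply: leq_trans (Scard x xW).
  rewrite imset_extend // setIUr.
  have := cardsD1 w W; rewrite wW.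
  have := (leq_card_setU (X :&: [set y]) (X :&: f @: D)).1.
  have := subset_leq_card (subsetIr X [set y]); rewrite cards1.
  by lia.
exists g; split.
- by rewrite -DWE.
- by move=> x xD; rewrite gf ?fE // !inE xD orbT.
- move=> x xW; case: (eqVneq x w) => [->|xw]; last by apply: gX; rewrite !inE xw.
  by rewrite gf ?setU11 // extend_same.
Qed.

Lemma partial_embedding_copy f : partial_embedding setT f -> contains_copy G T.
Proof.
move=> [finj fhom].
pose e : rel G := fun x y =>
  [exists u, [exists v, [&& f u == x, f v == y & sedge u v]]].
have eP x y : reflect (exists u v, [/\ f u = x, f v = y & sedge u v]) (e x y).
  apply: (iffP existsP) => [[u /existsP[v /and3P[/eqP ? /eqP ? ?]]]|].
    by exists u, v.
  by move=> [u [v [<- <- uv]]]; exists u; apply/existsP; exists v; rewrite !eqxx.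
have fI u v : f u = f v -> u = v by apply: finj; rewrite inE.
have esym : symmetric e.
  move=> x y; apply/eP/eP => -[u [v [<- <- uv]]]; exists v, u;
  by rewrite sedge_sym.
have evert x y : e x y -> x \in f @: setT.
  by move=> /eP[u [v [<- _ _]]]; rewrite imset_f.
have esub x y : e x y -> sedge x y.
  by move=> /eP[u [v [<- <- uv]]]; apply: fhom; rewrite ?inE.
pose H := Subgraph esym evert esub; exists H.
have fH u : f u \in sub_verts H by rewrite imset_f.
exists (fun u => exist _ (f u) (fH u) : H).
  have inv (y : H) : exists u, f u = val y.
    by case: y => y /= /imsetP[u _ ->]; exists u.
  have inv' (y : H) : exists u, f u == val y by have [u <-] := inv y; exists u.
  exists (fun y => xchoose (inv' y)) => [u|y].
    by apply: fI; apply/eqP/(xchooseP (inv' _)).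
  by apply/val_inj => /=; apply/eqP/(xchooseP (inv' y)).
move=> u v; rewrite /= /sub_rel /=; apply/eP/idP => [[u' [v' [/fI-> /fI->]]] //|uv].
by exists u, v.
Qed.

End PartialEmbeddings.

(** * Trees: edge counts, branches and well-spread vertices *)

Section Trees.
Variable T : sgraph.

Lemma connect_invariant (A : finType) (e : rel A) (D : {set A}) x y :
  (forall a b, a \in D -> e a b -> b \in D) -> connect e x y -> x \in D -> y \in D.
Proof.
move=> clD /connectP[p + ->]; elim: p x => //= a p IHp x /andP[xa pa] xD.
by apply: IHp => //; apply: clD xa.
Qed.

Lemma connected_boundary (D : {set T}) x y :
  connected T -> x \in D -> y \notin D ->
  exists a b, [/\ a \in D, b \notin D & sedge a b].
Proof.
move=> [_ connT] xD yD.
case: (pickP [pred p : T * T | [&& p.1 \in D, p.2 \notin D & sedge p.1 p.2]]).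
  by move=> [a b] /and3P[]; exists a, b.
move=> noedge; case/negP: yD; apply: connect_invariant (connT x y) xD.
move=> a b aD ab; have := noedge (a, b); rewrite /= aD ab andbT /=.
by move/negbFE.
Qed.

(** A vertex set is grown from one vertex along boundary edges; each added vertex brings an edge not
    spanned before. *)
Lemma connected_card_le : connected T -> #|T| <= #|edge_set T|.+1.
Proof.
move=> connT; have [/card_gt0P[r _] _] := connT.
suff grow n : n < #|T| -> exists D : {set T}, [/\ #|D| = n.+1, r \in D
    & n <= #|[set e in edge_set T | e \subset D]|].
  have T_gt0 : 0 < #|T| by case: connT.
  have [|D [_ _ le]] := grow #|T|.-1; first by lia.
  have : #|[set e in edge_set T | e \subset D]| <= #|edge_set T|.
    by apply/subset_leq_card/subsetP=> e; rewrite inE => /andP[].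
  by lia.
elim: n => [|n IHn] nT; first by exists [set r]; rewrite cards1 set11.
have [D [cD rD eD]] := IHn (ltnW nT).
have [y yD] : exists y, y \notin D.
  apply/existsP; rewrite -negb_forall; apply/negP => /forallP all.
  have : #|T| <= #|D| by apply/subset_leq_card/subsetP => x _; apply: all.
  by rewrite cD; lia.
have [a [x [aD xD ax]]] := connected_boundary _ _ _ connT rD yD.
exists (x |: D); split; [by rewrite cardsU1 xD cD | by rewrite !inE rD orbT |].
apply: leq_trans (_ : #|[set a; x] |: [set e in edge_set T | e \subset D]| <= _).
  rewrite cardsU1.
  suff -> : [set a; x] \notin [set e in edge_set T | e \subset D] by [].
  by rewrite inE negb_and subUset !sub1set (negPf xD) andbF orbT.
apply/subset_leq_card/subsetP => e /setU1P[->|].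
  rewrite inE; apply/andP; split.
    by apply/imsetP; exists (a, x); rewrite ?inE.
  by apply/subsetP => u /set2P[]->; rewrite !inE ?eqxx ?aD ?orbT.
rewrite !inE => /andP[-> /subsetP eD'] /=.
by apply/subsetP => u /eD' uD; rewrite !inE uD orbT.
Qed.

Lemma edge_set_card_le (Delta : nat) :
  (forall x : T, degree x <= Delta) -> #|edge_set T| <= #|T| * Delta.
Proof.
move=> degT; apply: leq_trans (leq_imset_card _ _) _.
rewrite -sum1_card (eq_bigl (fun p => xpredT p.1 && sedge p.1 p.2)); last first.
  by move=> p; rewrite inE.
rewrite -(pair_big_dep xpredT (fun x y : T => sedge x y) (fun _ _ => 1)) /=.
rewrite -sum_nat_const; apply: leq_sum => x _; apply: leq_trans (degT x).
by rewrite sum1_card /degree cardsE.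
Qed.

(** For an edge [uv] of a tree, this is the component of [u] once that edge is removed: it suffices
    to forbid steps into [v]. *)
Definition branch (u v : T) : {set T} :=
  [set x | connect [rel a b | sedge a b && (b != v)] u x].

Lemma branch_root u v : u \in branch u v.
Proof. by rewrite inE. Qed.

Lemma branch_step u v x y :
  x \in branch u v -> sedge x y -> y != v -> y \in branch u v.
Proof.
rewrite !inE => ux xy yv; apply: connect_trans ux _.
by apply: connect1; rewrite /= xy yv.
Qed.

Lemma branch_sub u v (D : {set T}) : u \in D ->
  (forall a b, a \in D -> sedge a b -> b != v -> b \in D) -> branch u v \subset D.
Proof.
move=> uD clD; apply/subsetP => x; rewrite inE => ux.
apply: connect_invariant ux uD => a b aD /andP[ab bv]; exact: clD ab bv.
Qed.

Lemma branch_avoids u v : u != v -> v \notin branch u v.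
Proof.
move=> uv; have /subsetP sub : branch u v \subset [set~ v].
  apply: branch_sub; first by rewrite !inE.
  by move=> a b _ _; rewrite !inE.
by apply/negP => /sub; rewrite !inE eqxx.
Qed.

Lemma sedge_neq (x y : T) : sedge x y -> x != y.
Proof. by apply: contraTneq => ->; rewrite sedge_irr. Qed.

(** Otherwise a path from [u] to [x] avoiding [v] would close up to a cycle through [v]. *)
Lemma branch_attached u v x :
  acyclic T -> sedge v u -> x \in branch u v -> sedge x v -> x = u.
Proof.
move=> acT vu; rewrite inE => /connectP[p0 p0P ->].
case: (shortenP p0P) => p pP puniq _ lv.
apply/eqP; case: p => [|a p] in pP puniq lv * => //.
have allv : all (fun b => b != v) (a :: p).
  have aux s b : path [rel a b | sedge a b && (b != v)] b s -> all (fun b => b != v) s.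
    by elim: s b => //= d s IHs b /andP[/andP[_ ->] /IHs].
  exact: aux pP.
(* This inequality is false by computation; deriving it from acyclicity is the contradiction. *)
suff : size [:: v, u, a & p] < 3 by [].
apply: acT; apply/andP; split.
  rewrite /cycle rcons_path; apply/andP; split=> //.
  apply/andP; split=> //; apply: sub_path pP => c d; by case/andP.
rewrite cons_uniq puniq andbT inE negb_or (sedge_neq _ _ vu) /=.
by apply/negP => /(allP allv); rewrite eqxx.
Qed.

Lemma branch_nested u v w : acyclic T -> sedge u v -> sedge u w -> w != v ->
  branch w u \subset branch u v :\ u.
Proof.
move=> acT uv uw wv.
have vw : v \notin branch w u.
  apply/negP => /(branch_attached _ _ _ acT uw).
  by rewrite sedge_sym uv => /(_ isT) vw; rewrite vw eqxx in wv.
have wu : w != u by rewrite eq_sym sedge_neq.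
(* Intersecting with [branch w u] makes the set closed: steps inside [branch w u] never reach [v],
   so they stay in [branch u v]. *)
suff /subsetP sub : branch w u \subset branch w u :&: (branch u v :\ u).
  by apply/subsetP => x /sub /setIP[].
have wuv : w \in branch u v by apply: branch_step uw wv; apply: branch_root.
apply: branch_sub; first by rewrite in_setI in_setD1 branch_root wu wuv.
move=> a b; rewrite !in_setI !in_setD1 => /and3P[awu au auv] ab bu.
have bwu := branch_step _ _ _ _ awu ab bu.
rewrite bwu bu /=; apply: branch_step auv ab _.
by apply: contraNneq vw => <-.
Qed.

Lemma branch_cover u v : u != v ->
  branch u v \subset u |: \bigcup_(w in neighbours u :\ v) branch w u.
Proof.
move=> uv; apply: branch_sub; first by rewrite setU11.
move=> a b /setU1P[->|/bigcupP[w wN aw]] ab bv; rewrite in_setU1.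
  apply/orP; right; apply/bigcupP; exists b; last exact: branch_root.
  by rewrite !inE bv.
case: (eqVneq b u) => //= bu; apply/bigcupP; exists w => //.
exact: branch_step aw ab bu.
Qed.

Lemma branches_total u v :
  connected T -> branch u v :|: branch v u = setT.
Proof.
move=> connT; apply/eqP; rewrite -subTset; apply/subsetP=> y _.
apply/negPn/negP => yD.
have uD : u \in branch u v :|: branch v u by rewrite in_setU branch_root.
have [a [b [aD bD ab]]] := connected_boundary _ _ _ connT uD yD.
case/negP: bD; move: aD; rewrite !in_setU => /orP[] aB; apply/orP.
  case: (eqVneq b v) => [->|bv]; first by right; apply: branch_root.
  by left; apply: branch_step aB ab bv.
case: (eqVneq b u) => [->|bu]; first by left; apply: branch_root.
by right; apply: branch_step aB ab bu.
Qed.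

(* A smallest branch with at least [m] vertices: the branches hanging off its
   root are smaller, hence have fewer than [m] vertices each. *)
Lemma medium_branch (Delta m : nat) : is_tree T ->
  (forall x : T, degree x <= Delta) -> 0 < m -> 2 * m <= #|T| ->
  exists u v : T, [/\ sedge u v, m <= #|branch u v| & #|branch u v| <= (Delta * m).+1].
Proof.
move=> [connT acT] degT m_gt0 mT.
pose P := [pred p : T * T | sedge p.1 p.2 && (m <= #|branch p.1 p.2|)].
have [p0 Pp0] : exists p, P p.
  (* The two branches of any edge cover [T], so one of them has at least [m] vertices and the
     minimum is over a nonempty family. *)
  have /card_gt1P[x [y [_ _ xy]]] : 1 < #|T| by lia.
  have yx : y \notin [set x] by rewrite inE eq_sym.
  have [a [b [_ _ ab]]] := connected_boundary _ _ _ connT (set11 x) yx.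
  have := (leq_card_setU (branch a b) (branch b a)).1.
  rewrite branches_total // cardsT => le.
  have [le1|lt1] := leqP m #|branch a b|; first by exists (a, b); rewrite /= ab.
  by exists (b, a); rewrite /= sedge_sym ab; lia.
case: (@arg_minnP _ p0 P (fun p => #|branch p.1 p.2|) Pp0) => -[u v] /=.
move=> /andP[uv mB] minB; exists u, v; split=> //.
apply: leq_trans (subset_leq_card (branch_cover _ _ (sedge_neq _ _ uv))) _.
apply: leq_trans (leq_card_setU _ _) _; rewrite cards1 add1n ltnS.
apply: leq_trans (card_bigcup_le _ _ _ _ m _) _.
  move=> w; rewrite !inE => /andP[wv uw].
  rewrite leqNgt; apply/negP => mw.
  have := minB (w, u); rewrite /= sedge_sym uw (ltnW mw) => /(_ isT).
  have := subset_leq_card (branch_nested _ _ _ acT uv uw wv).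
  by have := cardsD1 u (branch u v); rewrite branch_root; lia.
rewrite leq_mul2r; apply/orP; right.
apply: leq_trans (degT u); exact/subset_leq_card/subD1set.
Qed.

(** Greedy choice: each chosen vertex excludes only its ball of radius 2, which has at most
    [1 + Delta + Delta * Delta] vertices. *)
Lemma spread_set (Delta m : nat) :
  (forall x : T, degree x <= Delta) -> m * (1 + Delta + Delta * Delta) <= #|T| ->
  exists I : {set T}, #|I| = m /\
    {in I &, forall x y, x != y -> ~~ sedge x y /\ [disjoint neighbours x & neighbours y]}.
Proof.
move=> degT; elim: m => [|m IHm] mT.
  by exists set0; rewrite cards0; split=> // x y; rewrite inE.
have [|I [cI sI]] := IHm; first by apply: leq_trans mT; rewrite leq_mul2r leqnSn orbT.
pose N (x : T) := x |: (neighbours x :|: \bigcup_(y in neighbours x) neighbours y).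
have cN x : #|N x| <= 1 + Delta + Delta * Delta.
  rewrite /N; apply: leq_trans (leq_card_setU _ _) _; rewrite cards1 -addnA leq_add2l.
  apply: leq_trans (leq_card_setU _ _) _; apply: leq_add; first exact: degT.
  apply: leq_trans (card_bigcup_le _ _ _ _ Delta _) _; first by move=> y _; apply: degT.
  by rewrite leq_mul2r degT orbT.
have [z zN] : exists z, z \notin \bigcup_(x in I) N x.
  apply/existsP; rewrite -negb_forall; apply/negP => /forallP all.
  have : #|T| <= #|\bigcup_(x in I) N x|.
    by apply/subset_leq_card/subsetP => x _; apply: all.
  apply/negP; rewrite -ltnNge.
  apply: leq_ltn_trans (card_bigcup_le _ _ _ _ _ (fun x _ => cN x)) _.
  by rewrite cI; apply: leq_trans mT; rewrite mulSn; lia.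
have zI x : x \in I -> [/\ z != x, ~~ sedge x z & [disjoint neighbours x & neighbours z]].
  move=> xI; have zNx : z \notin N x.
    by apply: contra zN => zNx; apply/bigcupP; exists x.
  move: zNx; rewrite /N !inE !negb_or => /and3P[zx xz /bigcupP nz]; split=> //.
  rewrite -setI_eq0; apply/eqP/setP => y; rewrite !inE; apply/negP => /andP[xy zy].
  by apply: nz; exists y; rewrite inE // sedge_sym.
exists (z |: I); split.
  rewrite cardsU1 cI; case: (boolP (z \in I)) => // /zI[]; by rewrite eqxx.
move=> x y /setU1P[->|xI] /setU1P[->|yI]; first by rewrite eqxx.
- by move=> _; have [_ ? ?] := zI y yI; rewrite sedge_sym disjoint_sym.
- by move=> _; have [_ ? ?] := zI x xI.
- exact: sI.
Qed.

End Trees.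

(** * Embedding a branch, and completing an embedding *)

(** The branch is embedded vertex by vertex from [u], keeping the embedded part [D] connected. By
    acyclicity a new vertex has a single embedded neighbour [y], and [f y] has a free neighbour in
    [C] as long as [D] has fewer than [r] vertices. *)
Lemma embed_branch (T G : sgraph) (C : {set G}) (r : nat) (u v : T) (z c : G) :
  acyclic T -> sedge u v -> z \notin C -> c \in C -> sedge z c ->
  {in C, forall y, r <= #|neighbours y :&: C|} -> #|branch T u v| <= r ->
  exists f, [/\ partial_embedding T G (v |: branch T u v) f, f v = z
    & {in branch T u v, forall x, f x \in C}].
Proof.
move=> acT uv zC cC zc degC; set B := branch T u v => Br.
have uB : u \in B := branch_root T u v.
have vB : v \notin B := branch_avoids T u v (sedge_neq T u v uv).
suff grow n : n < #|B| -> exists (D : {set T}) (f : T -> G),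
    [/\ #|D| = n.+1, D \subset B, u \in D,
        {in D, forall y, connect [rel a b | [&& sedge a b, a \in D & b \in D]] u y}
      & [/\ partial_embedding T G (v |: D) f, f v = z
        & {in D, forall x, f x \in C}]].
  have B0 : 0 < #|B| by apply/card_gt0P; exists u.
  have [|D [f [cD DB _ _ [? ? ?]]]] := grow #|B|.-1; first by lia.
  have DE : D = B by apply/eqP; rewrite eqEcard DB cD; lia.
  by exists f; rewrite -DE.
elim: n => [|n IHn] nB.
  exists [set u], (extend T G (fun _ => z) u c).
  have vu : v != u by rewrite eq_sym (sedge_neq T).
  split; rewrite ?cards1 ?sub1set ?set11 //.
    by move=> y /set1P->.
  split; last by move=> x /set1P->; rewrite extend_same.
    rewrite setUC; apply: partial_embedding_extend.
    - by split=> x y /set1P-> /set1P-> //; rewrite sedge_irr.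
    - by rewrite inE eq_sym.
    - by apply: contra zC => /imsetP[x _ <-].
    - by move=> y _ _; rewrite sedge_sym.
  by rewrite /extend (negPf vu).
have [D [f [cD DB uD connD [embf fv fC]]]] := IHn (ltnW nB).
have vD : v \notin D by apply: contra vB; apply: subsetP.
have [y [x [yD xB xD yx]]] : exists y x, [/\ y \in D, x \in B, x \notin D & sedge y x].
  case: (pickP [pred p : T * T | [&& p.1 \in D, p.2 \in B, p.2 \notin D & sedge p.1 p.2]]).
    by move=> [a b] /and4P[]; exists a, b.
  move=> none; suff : B \subset D by move/subset_leq_card; lia.
  apply: branch_sub => // a b aD ab bv.
  have bB : b \in B by apply: branch_step ab bv; apply: (subsetP DB).
  have := none (a, b); rewrite /= aD bB ab andbT; exact: negbFE.
have xv : x != v by apply: contraNneq vB => <-.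
(* A neighbour of [v] in the branch is [u], already in [D]. A vertex [w] of [D] is joined to [y]
   inside [D], hence avoiding [x], so it lies in [branch y x], where only [y] is adjacent to [x]. *)
have adj w : w \in v |: D -> sedge x w -> w = y.
  move=> /setU1P[->|wD] xw.
    have xu := branch_attached T u v x acT _ xB xw.
    by rewrite xu ?uD // sedge_sym in xD.
  apply: (branch_attached T y x w acT); rewrite 1?sedge_sym // inE.
  have cs : connect_sym [rel a b | [&& sedge a b, a \in D & b \in D]].
    apply: sym_connect_sym => a b /=; rewrite sedge_sym; congr (_ && _).
    exact: andbC.
  have : connect [rel a b | [&& sedge a b, a \in D & b \in D]] y w.
    by apply: connect_trans (connD w wD); rewrite cs; apply: connD.
  apply: connect_sub => a b /and3P[ab aD bD]; apply: connect1; rewrite /= ab.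
  by apply: contraNneq xD => <-.
have [d dN dD] : exists2 d, d \in neighbours (f y) :&: C & d \notin f @: D.
  apply/subsetPn/negP => /subset_leq_card le.
  have le' := leq_trans (degC _ (fC y yD)) (leq_trans le (leq_imset_card f D)).
  by move: le'; rewrite cD => /(leq_trans (leq_trans nB Br)); rewrite ltnn.
move: dN => /setIP[]; rewrite inE => fyd dC.
have dvD : d \notin f @: (v |: D).
  by rewrite imsetU1 fv in_setU1 negb_or dD andbT; apply: contraNneq zC => <-.
have xvD : x \notin v |: D by rewrite !inE negb_or xv.
exists (x |: D), (extend T G f x d); split.
- by rewrite cardsU1 xD cD.
- by apply/subsetP => w /setU1P[->|/(subsetP DB)].
- by rewrite !inE uD orbT.
- have sub : {in D, forall w,
      connect [rel a b | [&& sedge a b, a \in x |: D & b \in x |: D]] u w}.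
    move=> w /connD; apply: connect_sub => a b /and3P[ab aD bD].
    by apply: connect1; rewrite /= ab !inE aD bD !orbT.
  move=> w /setU1P[->|]; last exact: sub.
  apply: connect_trans (sub y yD) _; apply: connect1.
  by rewrite /= yx !inE yD eqxx orbT.
- split.
  + rewrite setUCA; apply: partial_embedding_extend => // w wD xw.
    by rewrite (adj w wD xw) sedge_sym.
  + by rewrite /extend eq_sym (negPf xv).
  + move=> w /setU1P[->|wD]; first by rewrite extend_same.
    by rewrite (extend_in T G f D x d xD) ?fC.
Qed.

Lemma complete_embedding (T G : sgraph) (Delta b : nat) (X : {set G}) (D : {set T})
    (f : T -> G) :
  (forall x : T, degree x <= Delta) ->
  {in X, forall y, #|X :\: neighbours y| <= b} ->
  partial_embedding T G D f ->
  (forall w u, w \notin D -> u \in D -> sedge w u -> f u \in X) ->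
  Delta * b + #|X :&: f @: D| + #|T| <= #|X| + #|D| ->
  contains_copy G T.
Proof.
move=> degT defX embf nbX le.
have [||||g [embg _ _]] :=
  greedy_extension T G Delta b X (fun _ => X) D (~: D) f degT defX embf.
- by rewrite -setI_eq0 setICr.
- by [].
- by move=> w u; rewrite inE => wD uD wu; left; apply: nbX wu.
- by move=> w _; have := cardsC D; lia.
by apply: (partial_embedding_copy T G g); rewrite -(setUCr D).
Qed.

(** Elements are matched by their rank in the enumerations; [0 < #|I|] makes [B] inhabited, which
    supplies the default value of [nth]. *)
Lemma card_le_injection (A B : finType) (I : {set A}) (J : {set B}) :
  0 < #|I| <= #|J| ->
  exists f : A -> B, {in I &, injective f} /\ {in I, forall x, f x \in J}.
Proof.
case/andP=> I0 IJ; have /card_gt0P[z _] := leq_trans I0 IJ.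
have lt x : x \in I -> index x (enum I) < size (enum J).
  by move=> xI; rewrite -cardE; apply: leq_trans IJ; rewrite cardE index_mem mem_enum.
exists (fun x => nth z (enum J) (index x (enum I))); split.
  move=> x y xI yI /eqP; rewrite nth_uniq ?enum_uniq ?lt // => /eqP.
  by rewrite -!(mem_enum I) in xI yI *; apply: index_inj xI yI.
by move=> x xI; rewrite -mem_enum mem_nth ?lt.
Qed.

(** * Host graphs with an almost complete vertex set [X] *)

Section AlmostComplete.
Variables (T G : sgraph) (Delta b m : nat) (X : {set G}).
Hypothesis m_gt0 : 0 < m.
Hypothesis degT : forall x : T, degree x <= Delta.
Hypothesis defX : {in X, forall y, #|X :\: neighbours y| <= b}.
Hypothesis cardX : Delta * b + #|T| <= #|X| + m.

Lemma copy_many_attached (A : {set G}) :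
  m * (1 + Delta + Delta * Delta) <= #|T| -> m <= #|A| -> [disjoint A & X] ->
  {in A, forall z, Delta * b + Delta * m <= #|X :&: neighbours z|} ->
  contains_copy G T.
Proof.
move=> cardT mA dAX attA.
have [I [cI spreadI]] := spread_set T Delta m degT cardT.
have [|f [finj fA]] := card_le_injection T G I A; first by rewrite cI m_gt0.
have indI : {in I &, forall x y, ~~ sedge x y}.
  move=> x y xI yI; case: (eqVneq x y) => [->|xy]; first by rewrite sedge_irr.
  by have [] := spreadI x y xI yI xy.
pose NI := \bigcup_(x in I) neighbours x.
have dI : [disjoint I & NI].
  rewrite -setI_eq0; apply/eqP/setP => x; rewrite !inE; apply/negP.
  by move=> /andP[xI /bigcupP[y yI]]; rewrite inE; apply/negP/indI.
have embI : partial_embedding T G I f.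
  by split=> // x y xI yI xy; case/negP: (indI x y xI yI).
(* Since [I] is spread out, each [w] in [NI] has exactly one neighbour [x] in [I], so [S w] is all
   of [X :&: neighbours (f x)]. *)
pose S (w : T) := [set y in X | [forall u in I, sedge w u ==> sedge (f u) y]].
have XI0 : X :&: f @: I = set0.
  apply/setP => y; rewrite !inE; apply/negP => /andP[yX /imsetP[x xI yE]].
  by have := disjointFr dAX (fA x xI); rewrite -yE yX.
have [|||g [embg gf gX]] :=
  greedy_extension T G Delta b X S I NI f degT defX embI dI.
- by move=> w _; apply/subsetP => y; rewrite inE => /andP[].
- move=> w u _ uI wu; right; apply/subsetP => y; rewrite !inE => /andP[_].
  by move=> /forall_inP/(_ u uI)/implyP; apply.
- move=> w /bigcupP[x xI]; rewrite inE => xw; rewrite XI0 cards0 addn0.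
  apply: leq_trans (_ : #|X :&: neighbours (f x)| <= _).
    apply: leq_trans (attA _ (fA x xI)); rewrite leq_add2l mulnC -cI.
    by apply: card_bigcup_le => y _; apply: degT.
  apply/subset_leq_card/subsetP => y; rewrite !inE => /andP[-> fxy] /=.
  apply/forall_inP => u uI; apply/implyP => wu.
  case: (eqVneq u x) => [-> //|ux]; have [_ dux] := spreadI u x uI xI ux.
  have wNu : w \in neighbours u by rewrite inE sedge_sym.
  by have := disjointFr dux wNu; rewrite inE xw.
apply: (complete_embedding T G Delta b X (I :|: NI) g degT defX embg).
  move=> w u; rewrite in_setU negb_or => /andP[wI wN] /setUP[uI|/gX //] wu.
  by case/negP: wN; apply/bigcupP; exists u; rewrite // inE sedge_sym.
have DE : #|I :|: NI| = m + #|NI|.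
  by rewrite cardsU -cI; move: dI; rewrite -setI_eq0 => /eqP->; rewrite cards0 subn0.
(* The [m] vertices of [I] use up nothing of [X]: this is the slack [m] in [cardX]. *)
have : #|X :&: g @: (I :|: NI)| <= #|NI|.
  rewrite imsetU setIUr; apply: leq_trans (leq_card_setU _ _) _.
  have -> : g @: I = f @: I by apply: eq_in_imset.
  rewrite XI0 cards0 add0n.
  exact: leq_trans (subset_leq_card (subsetIr _ _)) (leq_imset_card _ _).
by rewrite DE; move: cardX; lia.
Qed.

Lemma copy_far_part (C : {set G}) (z c : G) :
  is_tree T -> 2 * m <= #|T| -> [disjoint C & X] ->
  z \notin C -> c \in C -> sedge z c ->
  Delta * b + Delta.+1 <= #|X :&: neighbours z| ->
  {in C, forall y, (Delta * m).+1 <= #|neighbours y :&: C|} ->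
  contains_copy G T.
Proof.
move=> treeT mT dCX zC cC zc attz degC; have [_ acT] := treeT.
have [u [v [uv mB Bm]]] := medium_branch T Delta m treeT degT m_gt0 mT.
have [f [embf fv fC]] := embed_branch T G C _ u v z c acT uv zC cC zc degC Bm.
have vB := branch_avoids T u v (sedge_neq T u v uv).
set B := branch T u v in mB embf fC vB; pose D := v |: B.
have onlyv w x : w \notin D -> x \in D -> sedge w x -> x = v.
  rewrite in_setU1 negb_or => /andP[wv wB] /setU1P[//|xB] wx.
  by case/negP: wB; apply: (branch_step T u v x w); rewrite // sedge_sym.
have XB0 : X :&: f @: B = set0.
  apply/setP => y; rewrite in_setI in_set0; apply/negP => /andP[yX /imsetP[x xI yE]].
  by have := disjointFr dCX (fC x xI); rewrite -yE yX.
(* The branch is mapped outside [X]; only [z] may lie in [X]. *)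
have XD1 : #|X :&: f @: D| <= 1.
  rewrite imsetU1 setIUr XB0 setU0.
  by apply: leq_trans (subset_leq_card (subsetIr _ _)) _; rewrite cards1.
(* As [z] need not lie in [X], the remaining neighbours of [v] are placed first, inside
   [X :&: neighbours z]; afterwards every embedded vertex with an unembedded neighbour is mapped
   into [X]. *)
pose W := neighbours v :\: D.
have dDW : [disjoint D & W].
  by rewrite -setI_eq0 /W setDE setICA setICr setI0.
have [|||g [embg gf gX]] :=
  greedy_extension T G Delta b X (fun _ => X :&: neighbours z) D W f degT defX embf dDW.
- by move=> w _; apply: subsetIl.
- move=> w x /setDP[_ wD] xD wx; right; rewrite (onlyv w x wD xD wx) fv.
  exact: subsetIr.
- move=> w _; apply: leq_trans attz.
  have : #|W| <= Delta := leq_trans (subset_leq_card (subsetDl _ _)) (degT v).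
  by lia.
apply: (complete_embedding T G Delta b X (D :|: W) g degT defX embg).
  move=> w x; rewrite in_setU negb_or => /andP[wD wW] /setUP[xD|/gX //] wx.
  by case/negP: wW; rewrite in_setD wD inE sedge_sym -(onlyv w x wD xD wx).
have DE : #|D :|: W| = 1 + #|B| + #|W|.
  rewrite cardsU; move: dDW; rewrite -setI_eq0 => /eqP->.
  by rewrite cards0 subn0 cardsU1 vB.
have : #|X :&: g @: (D :|: W)| <= 1 + #|W|.
  rewrite imsetU setIUr; apply: leq_trans (leq_card_setU _ _) _.
  have -> : g @: D = f @: D by apply: eq_in_imset.
  apply: leq_add XD1 _.
  exact: leq_trans (subset_leq_card (subsetIr _ _)) (leq_imset_card _ _).
by rewrite DE; move: cardX; lia.
Qed.

Lemma copy_almost_complete :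
  0 < Delta -> is_tree T -> connected G ->
  m * (1 + Delta + Delta * Delta) <= #|T| -> #|X| + m <= #|G| ->
  Delta * b + Delta * m + 1 + b <= #|X| ->
  (forall x : G, Delta * b + Delta * m + 1 + m + Delta * m <= degree x) ->
  contains_copy G T.
Proof.
move=> Delta_gt0 treeT connG cardT cardG tX degG.
(* One threshold for both cases: it exceeds [Delta * b + Delta * m], and, as [m] is positive, it is
   at least [Delta * b + Delta.+1]. *)
pose t := Delta * b + Delta * m + 1.
pose A := [set z | (z \notin X) && (t <= #|X :&: neighbours z|)].
have AX : [disjoint A & X].
  by rewrite -setI_eq0; apply/eqP/setP => z; rewrite !inE; case: (z \in X); rewrite ?andbF.
have [mA|Am] := leqP m #|A|.
  apply: (copy_many_attached A) => // z; rewrite inE => /andP[_].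
  by apply: leq_trans; rewrite leq_addr.
pose C := ~: (X :|: A).
have [x0 x0X] : exists x, x \in X by apply/card_gt0P; lia.
have [y0 y0C] : exists y, y \in C.
  apply/card_gt0P; have := cardsC (X :|: A); have := (leq_card_setU X A).1.
  by rewrite -/C; lia.
have x0C : x0 \in ~: C by rewrite setCK inE x0X.
have [|z [c [zC cC zc]]] := connected_boundary G (~: C) x0 y0 connG x0C.
  by rewrite in_setC negbK.
rewrite in_setC in zC; rewrite in_setC negbK in cC.
(* Outside [C], the vertex [z] is in [A], or it is in [X] and then misses at most [b] vertices of
   [X]. *)
have attz : t <= #|X :&: neighbours z|.
  move: zC; rewrite /C in_setC negbK => /setUP[zX|]; last by rewrite inE => /andP[].
  by have := defX z zX; have := cardsID (neighbours z) X; rewrite /t; lia.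
apply: (copy_far_part C z c) => //.
- by apply: leq_trans cardT; rewrite mulnC leq_mul2l; lia.
- by rewrite -setI_eq0; apply/eqP/setP => y; rewrite !inE; case: (y \in X); rewrite ?andbF.
- by apply: leq_trans attz; rewrite /t; nia.
(* Of its neighbours, [y] has fewer than [t] in [X] and fewer than [m] in [A]; the others are in
   [C]. *)
move=> y; rewrite inE => yC; have ydeg := degG y; rewrite /degree in ydeg.
have yt : #|X :&: neighbours y| < t.
  by move: yC; rewrite !inE; case: (y \in X) => //=; rewrite -ltnNge.
have := cardsID C (neighbours y).
have : #|neighbours y :\: C| <= #|X :&: neighbours y| + #|A|.
  apply: leq_trans (leq_card_setU _ _); apply/subset_leq_card/subsetP => x.
  rewrite /C in_setD in_setC negbK !in_setU in_setI => /andP[/orP[->|->] ->] //.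
  by rewrite orbT.
by move: yt; rewrite /t; lia.
Qed.

End AlmostComplete.

(** * Degrees in subgraphs and the numerical bounds *)

Lemma min_degree_le (G : sgraph) (x : G) : min_degree G <= degree x.
Proof.
rewrite /min_degree; have := mem_index_enum x.
elim: (index_enum G) => //= y s IHs; rewrite inE big_cons geq_min.
by case/predU1P=> [->|/IHs->]; rewrite ?leqnn ?orbT.
Qed.

Lemma degree_le_max (G : sgraph) (x : G) : degree x <= max_degree G.
Proof. exact: leq_bigmax. Qed.

Lemma card_subgraph (G : sgraph) (K : subgraph G) : #|K| = #|sub_verts K|.
Proof. by rewrite card_sig. Qed.

Lemma subgraph_degree_le (G : sgraph) (K : subgraph G) (x : K) :
  degree x <= #|sub_verts K :&: neighbours (val x)|.
Proof.
rewrite /degree -(card_imset _ val_inj); apply/subset_leq_card/subsetP => y.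
move=> /imsetP[y' + ->]; rewrite !inE => xy; rewrite (valP y').
exact: sub_edge_sub xy.
Qed.

(* [q] stands for the real number [eps * k], rounded up. *)
Lemma copy_of_nat_bounds (Delta k q : nat) (G : sgraph) (K : subgraph G) (T : sgraph) :
  0 < Delta -> 0 < q -> 750 * Delta ^ 7 * q <= k ->
  connected G -> k + q + 4 * Delta * q <= #|G| -> 20 * Delta ^ 2 * q <= min_degree G ->
  0 < #|K| -> #|K| <= k + q -> k <= min_degree K + q ->
  is_tree T -> #|edge_set T| = k -> max_degree T <= Delta -> contains_copy G T.
Proof.
move=> D0 q_gt0 qk connG cG dG K0 cK dK treeT eT dT.
have degT (x : T) : degree x <= Delta := leq_trans (degree_le_max T x) dT.
have [connT _] := treeT.
have T_le := connected_card_le T connT; rewrite eT in T_le.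
have T_ge := edge_set_card_le T Delta degT; rewrite eT in T_ge.
have [x0 _] : exists x : K, x \in predT by apply/card_gt0P.
rewrite card_subgraph in cK.
have degK (y : G) : y \in sub_verts K ->
    min_degree K <= #|sub_verts K :&: neighbours y|.
  move=> yK; apply: leq_trans (min_degree_le _ (exist _ y yK : K)) _.
  exact: subgraph_degree_le.
have KX : k <= #|sub_verts K| + q.
  have := degK _ (valP x0).
  have := subset_leq_card (subsetIl (sub_verts K) (neighbours (val x0))).
  by lia.
have D2 : Delta <= Delta ^ 2 by rewrite expnS expn1 leq_pmulr.
have D2' : Delta ^ 2 <= Delta ^ 7 by rewrite leq_pexp2l.
(* A vertex of [K] has at least [k - q] neighbours among at most [k + q] vertices, so it misses at
   most [2 * q]. With [#|T| <= k + 1] and at least [k - q] vertices in [K], the choice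
   [m = 4 * Delta * q] covers the loss [2 * Delta * q + q + 1]. *)
apply: (copy_almost_complete T G Delta (2 * q) (4 * Delta * q) (sub_verts K)) => //.
- by nia.
- by move=> y yK; have := degK y yK; have := cardsID (neighbours y) (sub_verts K); lia.
- by nia.
(* The size of [T] is bounded below only through [k <= #|T| * Delta], hence the extra factor
   [Delta]. *)
- rewrite -(leq_pmul2r D0); apply: leq_trans T_ge; apply: leq_trans qk.
  have -> : 4 * Delta * q * (1 + Delta + Delta * Delta) * Delta =
            4 * (Delta ^ 2 + Delta ^ 2 * Delta + Delta ^ 2 * Delta ^ 2) * q.
    by rewrite expnS expn1; ring.
  rewrite leq_mul2r; apply/orP; right.
  have le4 : Delta ^ 2 * Delta ^ 2 <= Delta ^ 7 by rewrite -expnD leq_pexp2l.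
  have le3 : Delta ^ 2 * Delta <= Delta ^ 7 by rewrite -expnSr leq_pexp2l.
  by lia.
- by lia.
- by nia.
- by move=> x; apply: leq_trans (min_degree_le G x); apply: leq_trans dG; nia.
Qed.

Local Open Scope ring_scope.


Theorem theorem1p5 (R : realType) (Delta k : nat) (eps : R) (G : sgraph)
    (K : subgraph G) (T : sgraph)
    (Delta_gt0 : (0 < Delta)%N) (k_gt0 : (0 < k)%N)
    (eps_le : eps <= Delta%:R ^- 7 / 1000) (eps_ge : 3 * k%:R^-1 <= eps)
    (G_conn : connected G)
    (G_card : (1 + 256 * Delta%:R ^+ 2 * Num.sqrt eps) * k%:R <= #|G|%:R)
    (G_deg : 128 * Delta%:R ^+ 2 * Num.sqrt eps * k%:R <= (min_degree G)%:R)
    (K_gt0 : (0 < #|K|)%N)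
    (K_card : #|K|%:R <= (1 + eps) * k%:R)
    (K_deg : (1 - eps) * k%:R <= (min_degree K)%:R)
    (T_tree : is_tree T) (T_edges : #|edge_set T| = k)
    (T_deg : (max_degree T <= Delta)%N) :
  contains_copy G T.
Proof.
have k0 : 0 < k%:R :> R by rewrite ltr0n.
have D1 : 1 <= Delta%:R :> R by rewrite ler1n.
set x : R := eps * k%:R.
have x3 : 3 <= x by rewrite /x -ler_pdivrMr.
have eps0 : 0 < eps by rewrite -(pmulr_lgt0 _ k0); apply: lt_le_trans x3.
pose P : R := Delta%:R ^+ 2; pose P7 : R := Delta%:R ^+ 7.
have DP : Delta%:R <= P by rewrite /P expr2 ler_peMr // ler0n.
have P7ge : 1 <= P7 by rewrite exprn_ege1.
have P7eps : eps * (1000 * P7) <= 1.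
  rewrite -ler_pdivlMr; last by lra.
  by apply: le_trans eps_le _; rewrite -/P7 mul1r [X in _ <= X]invfM mulrC.
have P7x : 1000 * P7 * x <= k%:R by rewrite /x mulrA ger_pMl // mulrC.
have eps1 : eps <= 1 by apply: le_trans _ P7eps; rewrite ler_peMr ?(ltW eps0) //; lra.
(* Through this, the hypotheses in [Num.sqrt eps * k] yield bounds in [x = eps * k]. *)
have sqrt_ge : eps <= Num.sqrt eps.
  rewrite -[X in X <= _](sqr_sqrtr (ltW eps0)) expr2 ger_pMl ?sqrtr_gt0 //.
  by rewrite -sqrtr1 ler_wsqrtr.
have Px : P * x <= P * (Num.sqrt eps * k%:R).
  by rewrite /x; apply: ler_wpM2l; [lra | apply: ler_wpM2r => //; lra].
have Px0 : 0 <= P * x by apply: mulr_ge0; lra.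
have /andP[q_le q_gt] := truncn_itv (ltW (lt_le_trans (ltr0n R 3) x3)).
set q := (Num.truncn x).+1 in q_gt.
(* Rounding up adds at most 1, which is at most [x / 3] because [x >= 3]; the factor [4 / 3] turns
   the constant 1000 into 750. *)
have qx : q%:R <= 4 / 3 * x by rewrite /q -natr1; lra.
have q0 : 0 <= q%:R :> R by rewrite ler0n.
have Pq : P * q%:R <= P * (4 / 3 * x) by apply: ler_wpM2l; lra.
apply: (copy_of_nat_bounds Delta k q G K T) => //.
- rewrite -(ler_nat R) 2!natrM natrX -/P7; apply: le_trans _ P7x.
  have : P7 * q%:R <= P7 * (4 / 3 * x) by apply: ler_wpM2l; lra.
  by lra.
- rewrite -(ler_nat R) !natrD !natrM; apply: le_trans _ G_card.
  have : Delta%:R * q%:R <= P * q%:R by apply: ler_wpM2r.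
  have : q%:R <= P * q%:R by rewrite ler_peMl //; lra.
  by rewrite -/P; lra.
- by rewrite -(ler_nat R) 2!natrM natrX; apply: le_trans _ G_deg; rewrite -/P; lra.
- rewrite -(ler_nat R) natrD; apply: le_trans K_card _.
  by rewrite mulrDl mul1r -/x; lra.
- rewrite -(ler_nat R) natrD; move: K_deg.
  by rewrite mulrBl mul1r -/x; lra.
Qed.
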